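(* Let $T, R_n, U_n : H\to V\subset H$, $n\in\mathbb{N}$, be increasing mappings. Assume further: (i) $T:V\to V$ is completely continuous with respect to monotone sequences, i.e., if $v_n\rightharpoonup v$ in $V$ and $v_n\le v_{n+1}$ for all $n\in\mathbb{N}$ (or $v_n\ge v_{n+1}$ for all $n\in\mathbb{N}$), then $T(v_n)\to T(v)$ in $V$. (ii) The sets of fixed points of $T, R_n, U_n$ (assuming they exist) are uniformly bounded in $V$ with respect to $n\in\mathbb{N}$, and $$\underline{y}\le R_n(v)\le R_{n+1}(v)\le T(v)\le U_{n+1}(v)\le U_n(v)\le \overline{y},\qquad \forall v\in[\underline{y},\overline{y}],\ n\in\mathbb{N},$$ for some $\underline{y},\overline{y}\in V$ with $\underline{y}\le\overline{y}$. (iii) If $\{v_n\}$ and $\{w_n\}$ are bounded sequences in $V$ such that $v_n\le v_{n+1}\le\overline{y}$ and $w_n\ge w_{n+1}\ge\underline{y}$ for all $n$, then $$\lim_{n\to\infty}\|R_n(v_n)-T(v_n)\|_V=0\quad\text{and}\quad \lim_{n\to\infty}\|U_n(w_n)-T(w_n)\|_V=0.$$ For an increasing map $S$ having $\underline{y}$ as sub-solution and $\overline{y}$ as super-solution, let $\mathbf{m}(S)$ and $\mathbf{M}(S)$ denote the smallest and the largest fixed point of $S$ in $[\underline{y},\overline{y}]$, respectively. Then, as $n\to\infty$, $$\mathbf{m}(R_n)\to\mathbf{m}(T)\ \text{in } V,\qquad \mathbf{M}(U_n)\to\mathbf{M}(T)\ \text{in } V,$$ and $$\mathbf{m}(R_n)\uparrow\mathbf{m}(T)\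 \text{in } H,\qquad \mathbf{M}(U_n)\downarrow\mathbf{M}(T)\ \text{in } H.$$
   Context: $(V,H,V')$ is a Gelfand triple of Hilbert spaces: $V\hookrightarrow H\hookrightarrow V'$ with dense and continuous embeddings, $H$ identified with $H'$; $(\cdot,\cdot)$ is the inner product of $H$. $H^+\subset H$ is a closed convex cone with $H^+=\{v\in H:(v,y)\ge0\ \forall y\in H^+\}$, and $x\le y$ means $y-x\in H^+$. For $x\in H$, $x^+$ is the orthogonal projection of $x$ onto $H^+$ and $x^-:=x^+-x$; $\sup(x,y):=x+(y-x)^+$, $\inf(x,y):=x-(x-y)^+$. It is assumed that $y\in V$ implies $y^+\in V$, and $\|y^+\|_V\le M\|y\|_V$ for all $y\in V$ and some $M>0$. $V$ and $H$ are spaces of functions $h:\Omega\to\mathbb{R}$ on an open set $\Omega\subset\mathbb{R}^N$, with $L^\infty(\Omega)\hookrightarrow H$ densely and continuously, and $L^\infty(\Omega)$ inherits the order of $H$ (prototype: $V=H_0^1(\Omega)$, $H=L^2(\Omega)$, $H^+$ the a.e. non-negative functions). For $x\le y$ in $H$, $[x,y]:=\{z\in H:x\le z\le y\}$. $z_n\uparrow z$ in $H$ means $z_n\le z_{n+1}$ for all $n$ and $z_n\to z$ in $H$; $z_n\downarrow z$ in $H$ means $z_n\ge z_{n+1}$ for all $n$ and $z_n\to z$ in $H$. A map $T:H\to H$ is increasing if $v\le w$ implies $T(v)\le T(w)$. $\underline{y}$ is a sub-solution of $T$ if $\underline{y}\le T(\underline{y})$; $\overline{y}$ is a super-solution if $T(\overline{y})\le\overline{y}$.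 By the Birkhoff–Tartar theorem, an increasing map with sub-solution $\underline{y}$ and super-solution $\overline{y}$, $\underline{y}\le\overline{y}$, has a smallest and a largest fixed point in $[\underline{y},\overline{y}]$. *)

(* Defs.v *)
From HB Require Import structures.
From mathcomp Require Import all_boot all_order all_algebra.
From mathcomp Require Import all_classical all_reals all_analysis.

Set Implicit Arguments.
Unset Strict Implicit.
Unset Printing Implicit Defensive.

Import Order.TTheory GRing.Theory Num.Theory.
Import numFieldNormedType.Exports.

Local Open Scope classical_set_scope.
Local Open Scope ring_scope.

HB.mixin Record CompleteNormedModule_isHilbert (R : realType) H
    of CompleteNormedModule R H := {
  inner : H -> H -> R ;
  innerC : forall x y, inner x y = inner y x ;
  innerPl : forall a x y z, inner (a *: x + y) z = a * inner x z + inner y z ;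
  innerxx : forall x, inner x x = `|x| ^+ 2
}.

#[short(type="hilbertType")]
HB.structure Definition Hilbert (R : realType) :=
  { H of CompleteNormedModule R H & CompleteNormedModule_isHilbert R H }.

Section Lebesgue.
Context {R : realType} {N : nat}.
Implicit Types (a b : 'rV[R]_N) (A Omega : set 'rV[R]_N) (f : 'rV[R]_N -> R).

Definition box a b : set 'rV[R]_N :=
  [set x | forall j, a 0 j <= x 0 j <= b 0 j].

Definition box_volume a b : R := \prod_(j < N) Num.max 0 (b 0 j - a 0 j).

Definition lebesgue_outer A : \bar R :=
  ereal_inf [set s | exists a b : nat -> 'rV[R]_N,
    A `<=` \bigcup_k box (a k) (b k) /\
    s = (\sum_(0 <= k <oo) (box_volume (a k) (b k))%:E)%E].

Definition ae_on Omega (P : 'rV[R]_N -> Prop) : Prop :=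
  lebesgue_outer [set x | Omega x /\ ~ P x] = 0%E.

Definition lebesgue_measurable_on Omega f : Prop :=
  forall B : set R, measurable B ->
    caratheodory_measurable lebesgue_outer (Omega `&` f @^-1` B).

(* [f] represents an element of L^oo(Omega) of norm at most [C]. *)
Definition Linfty_le Omega f (C : R) : Prop :=
  [/\ lebesgue_measurable_on Omega f, 0 <= C &
      ae_on Omega (fun x => `|f x| <= C)].

End Lebesgue.

Section FunctionSpace.
Context {R : realType} {N : nat} {H : hilbertType R}.
Implicit Types (Omega : set 'rV[R]_N) (ev : H -> 'rV[R]_N -> R).

(* [ev h] is a representative of [h]; only its values on [Omega] matter, and
   functions that agree almost everywhere on [Omega] are identified. *)
Record function_space Omega ev : Prop := {
  ev_linear : forall (a : R) (g h : H),
    ae_on Omega (fun x => ev (a *: g + h) x = a * ev g x + ev h x) ;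
  ev_inj : forall g h : H, ae_on Omega (fun x => ev g x = ev h x) -> g = h
}.

Record Linfty_embedded Omega ev : Prop := {
  Linfty_continuous : exists K : R, forall f C, Linfty_le Omega f C ->
    exists h : H, ae_on Omega (fun x => ev h x = f x) /\ `|h| <= K * C ;
  Linfty_dense : dense [set h : H | exists C, Linfty_le Omega (ev h) C]
}.

End FunctionSpace.

Section Order.
Context {R : realType} {H : hilbertType R}.
Implicit Types (P : set H) (x y z : H).

Record self_dual_cone P : Prop := {
  cone_closed : closed P ;
  cone_add : forall x y, P x -> P y -> P (x + y) ;
  cone_scale : forall (a : R) x, 0 <= a -> P x -> P (a *: x) ;
  cone_self_dual : P = [set v | forall y, P y -> 0 <= inner v y]
}.

Definition cone_le P x y : Prop := P (y - x).

Definition cone_itv P x y : set H := [set z | cone_le P x z /\ cone_le P z y].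

(* x^+, the orthogonal projection of x onto the cone (for a nonempty closed
   convex [P] the nearest point exists and is unique). *)
Definition pos_part P x : H :=
  [get p | P p /\ forall q, P q -> `|x - p| <= `|x - q|].

Definition increases_to P (z : nat -> H) (l : H) : Prop :=
  (forall n, cone_le P (z n) (z n.+1)) /\ z @ \oo --> l.

Definition decreases_to P (z : nat -> H) (l : H) : Prop :=
  (forall n, cone_le P (z n.+1) (z n)) /\ z @ \oo --> l.

Definition is_smallest_fixpoint P (S : H -> H) (a b m : H) : Prop :=
  [/\ cone_itv P a b m, S m = m &
      forall z, cone_itv P a b z -> S z = z -> cone_le P m z].

Definition is_largest_fixpoint P (S : H -> H) (a b m : H) : Prop :=
  [/\ cone_itv P a b m, S m = m &
      forall z, cone_itv P a b z -> S z = z -> cone_le P z m].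

End Order.

Section GelfandTriple.
Context {R : realType} {V H : hilbertType R}.
Implicit Types (i : {linear V -> H}) (P : set H).

(* V' consists of the continuous [phi : {scalar V}] with the operator norm, and
   the identification of H with H' embeds [h] in V' as [v |-> inner h (i v)]. *)
Record gelfand_triple i : Prop := {
  V_H_inj : injective i ;
  V_H_continuous : continuous i ;
  V_H_dense : dense (range i) ;
  H_V'_inj : forall h : H, (forall v, inner h (i v) = 0) -> h = 0 ;
  H_V'_continuous : exists C : R, forall (h : H) (v : V),
    `|inner h (i v)| <= C * `|h| * `|v| ;
  H_V'_dense : forall phi : {scalar V}, continuous phi ->
    forall e : R, 0 < e ->
    exists h : H, forall v, `|phi v - inner h (i v)| <= e * `|v|
}.

Definition weakly_converges (v : nat -> V) (l : V) : Prop :=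
  forall phi : {scalar V}, continuous phi -> phi (v n) @[n --> \oo] --> phi l.

Definition pos_part_bounded i P : Prop :=
  exists M : R, 0 < M /\
    forall y : V, exists z : V, i z = pos_part P (i y) /\ `|z| <= M * `|y|.

Definition increasing i P (S : H -> V) : Prop :=
  forall v w : H, cone_le P v w -> cone_le P (i (S v)) (i (S w)).

(* Elements of H that lie in V, converging in the norm of V. *)
Definition converges_in_V i (x : nat -> H) (l : H) : Prop :=
  exists (v : nat -> V) (u : V),
    [/\ forall n, i (v n) = x n, i u = l & v @ \oo --> u].

End GelfandTriple.

(* Main.v *)
(** Order intervals of a self-dual cone are chain complete, because
[|y - x|^2 + |z - y|^2 <= |z - x|^2] for [x <= y <= z]. Hence, by Zorn, an
increasing self-map of an interval has a fixed point below all points [z] with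
[S z <= z] (and the cone need not be a lattice cone). The smallest fixed points
[m(R_n)] therefore increase, stay below [m(T)], and converge in H to some [h];
being bounded in V they converge weakly in V, so that [m(R_n) = R_n (m(R_n))]
has the same limit in V as [T (m(R_n))], namely [T h]. Thus [h] is a fixed point
of [T] below [m(T)], i.e. [h = m(T)]. The largest fixed points are the smallest
ones for the order of the opposite cone. *)
From HB Require Import structures.
Require Import Defs.
From mathcomp Require Import all_boot all_order all_algebra.
From mathcomp Require Import all_classical all_reals all_analysis.
From mathcomp Require Import ring lra.

Set Implicit Arguments.
Unset Strict Implicit.
Unset Printing Implicit Defensive.

Import Order.TTheory GRing.Theory Num.Theory.
Import numFieldNormedType.Exports.

Local Open Scope classical_set_scope.
Local Open Scope ring_scope.

(** * Inner product spaces: Cauchy-Schwarz and Riesz representation *)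

Section InnerProduct.
Context {R : realType} {E : hilbertType R}.
Implicit Types (x y z : E) (a : R).

Lemma innerDl x y z : inner (x + y) z = inner x z + inner y z.
Proof. by rewrite -[x in LHS]scale1r innerPl mul1r. Qed.

Lemma inner0l z : inner 0 z = 0.
Proof. by apply: (addrI (inner 0 z)); rewrite -innerDl !addr0. Qed.

Lemma innerZl a x z : inner (a *: x) z = a * inner x z.
Proof. by rewrite -[a *: x]addr0 innerPl inner0l addr0. Qed.

Lemma innerNl x z : inner (- x) z = - inner x z.
Proof. by rewrite -scaleN1r innerZl mulN1r. Qed.

Lemma innerDr x y z : inner x (y + z) = inner x y + inner x z.
Proof. by rewrite !(innerC x) innerDl. Qed.

Lemma innerZr a x z : inner x (a *: z) = a * inner x z.
Proof. by rewrite !(innerC x) innerZl. Qed.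

Lemma innerNr x z : inner x (- z) = - inner x z.
Proof. by rewrite !(innerC x) innerNl. Qed.

(** Makes [inner x] a [{scalar E}], so that [H_V'_dense] and [weakly_converges] can be applied to
    it. *)
HB.instance Definition _ x := GRing.isLinear.Build R E R *%R (inner x)
  (fun a y z => etrans (innerDr x (a *: y) z) (congr1 (+%R^~ _) (innerZr a x y))).

Lemma sqr_normD x y : `|x + y| ^+ 2 = `|x| ^+ 2 + 2 * inner x y + `|y| ^+ 2.
Proof. rewrite -!innerxx innerDl !innerDr (innerC y x); ring. Qed.

Lemma cauchy_schwarz x y : `|inner x y| <= `|x| * `|y|.
Proof.
rewrite -(@ler_pXn2r _ 2) ?nnegrE ?mulr_ge0// real_normK ?num_real// exprMn.
have [->|y0] := eqVneq y 0; first by rewrite innerC inner0l normr0 !expr0n mulr0.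
have {}y0 : 0 < `|y| ^+ 2 by rewrite exprn_gt0// normr_gt0.
(* This square equals |y|^2 (|x|^2 |y|^2 - (x,y)^2). *)
have : 0 <= `|(`|y| ^+ 2) *: x + (- inner x y) *: y| ^+ 2 by rewrite exprn_ge0.
rewrite -innerxx innerDl !innerDr !innerZl !innerZr (innerC y x) !innerxx.
set A := `|x| ^+ 2; set B := `|y| ^+ 2; set c := inner x y => h.
rewrite -subr_ge0 -(pmulr_rge0 _ y0); apply: le_trans h _; rewrite -/B; nra.
Qed.

Lemma inner_continuous x : continuous (inner x).
Proof.
move=> y; apply/cvgrPdist_le => e e0.
have x0 : 0 < `|x| + 1 by rewrite ltr_wpDl.
near=> z; rewrite -innerNr -innerDr (le_trans (cauchy_schwarz _ _))//.
have : `|y - z| <= e / (`|x| + 1).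
  by near: z; apply: cvgr_dist_le; [exact: cvg_id | rewrite divr_gt0].
rewrite ler_pdivlMr// => h; apply: le_trans h; rewrite mulrC ler_wpM2l//; lra.
Unshelve. all: by end_near. Qed.

Lemma cvg_inner (u : nat -> E) x y :
  u @ \oo --> y -> inner x (u n) @[n --> \oo] --> inner x y.
Proof. by move=> uy; apply: continuous_cvg => //; exact: inner_continuous. Qed.

(** Meant for extremizing sequences: [g n] is a multiple of the bound on the optimality gap of
    [u n], both in [riesz] and in [chain_sup]. *)
Lemma cvg_dist_sqr (u : nat -> E) (g : nat -> R) :
  (forall m n, `|u m - u n| ^+ 2 <= g m + g n) -> g @ \oo --> 0 ->
  cvg (u @ \oo).
Proof.
move=> ug g0; apply/cauchy_cvgP/cauchy_exP => e e0.
have h : \forall n \near \oo, `|g n| < e ^+ 2 / 2.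
  by apply: cvgr0_norm_lt; [exact: g0 | rewrite divr_gt0// exprn_gt0].
near \oo => n; exists (u n).
suff : \forall m \near \oo, ball (u n) e (u m) by [].
near=> m; rewrite /= -ball_normE /=.
rewrite -(@ltr_pXn2r _ 2) ?nnegrE ?(ltW e0)//; apply: (le_lt_trans (ug _ _)).
have gn : `|g n| < e ^+ 2 / 2 by near: n.
have gm : `|g m| < e ^+ 2 / 2 by near: m.
have := ler_norm (g n); have := ler_norm (g m); lra.
Unshelve. all: by end_near. Qed.

(** A minimizing sequence of J(v) = |v|^2 - 2 phi(v) converges, and the first-order condition at its
    limit represents phi. Here [phi] is a bare function, so that pointwise limits of functionals
    qualify. *)
Lemma riesz (phi : E -> R) (C : R) :
  (forall a x y, phi (a *: x + y) = a * phi x + phi y) ->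
  (forall x, `|phi x| <= C * `|x|) ->
  exists w, phi = inner w.
Proof.
move=> phiP phiC.
pose J v := `|v| ^+ 2 - 2 * phi v.
have J_lb : has_inf (range J).
  split; first by exists (J 0), 0.
  exists (- C ^+ 2) => _ [v _ <-]; rewrite /J.
  have := sqr_ge0 (`|v| - C); have := phiC v; have := ler_norm (phi v); nra.
pose m := inf (range J).
have mJ v : m <= J v by apply: ge_inf; [exact: J_lb.2 | exists v].
have /choice[u uJ] : forall n : nat, exists v, J v < m + harmonic n.
  move=> n; have [|_ [v _ <-] ?] := @inf_adherent _ _ (harmonic n) _ J_lb.
    exact: harmonic_gt0.
  by exists v.
have phiD x y : phi (x + y) = phi x + phi y.
  by rewrite -[x in LHS]scale1r phiP mul1r.
have phi0 : phi 0 = 0 by apply: (addrI (phi 0)); rewrite -phiD !addr0.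
have phiZ a x : phi (a *: x) = a * phi x.
  by rewrite -[a *: x]addr0 phiP phi0 addr0.
have JD (v d : E) t :
    J (v + t *: d) = J v + 2 * t * (inner v d - phi d) + t ^+ 2 * `|d| ^+ 2.
  rewrite /J sqr_normD phiD phiZ innerZr normrZ exprMn real_normK ?num_real//.
  ring.
have /cvg_ex[/= w uw] : cvg (u @ \oo).
  apply: (@cvg_dist_sqr _ (fun n => 2 * harmonic n)); last first.
    by rewrite -(mulr0 2); apply: cvgMr; exact: cvg_harmonic.
  (* With d = u_k - u_n, the expansions at t = 1 and t = 1/2 give |d|^2 / 2 = J(u_k) + J(u_n) - 2
     J(u_n + d/2), and the midpoint value is at least m. *)
  move=> k n.
  have := JD (u n) (u k - u n) 1; have := JD (u n) (u k - u n) (2^-1).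
  rewrite scale1r (addrC (u n) (u k - u n)) subrK => e1 e2.
  have := mJ (u n + 2^-1 *: (u k - u n)); have := uJ n; have := uJ k.
  rewrite e1; lra.
exists w; apply/funext => d; apply/esym/eqP; rewrite -subr_eq0.
(* Limit of J(u_n + t d) - J(u_n) + [harmonic n] >= 0, in which u_n enters only through (d, u_n). *)
have key t : 0 <= 2 * t * (inner d w - phi d) + t ^+ 2 * `|d| ^+ 2.
  have cv : (2 * t * (inner d (u n) - phi d) + t ^+ 2 * `|d| ^+ 2 + harmonic n)
      @[n --> \oo] -->
      2 * t * (inner d w - phi d) + t ^+ 2 * `|d| ^+ 2 + 0.
    apply: cvgD; last exact: cvg_harmonic.
    apply: cvgD; last exact: cvg_cst.
    apply: cvgMr; apply: cvgB; last exact: cvg_cst.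
    exact: cvg_inner.
  rewrite addr0 in cv; rewrite -(cvg_lim _ cv)//.
  apply: limr_ge; first by apply/cvg_ex; eexists; exact: cv.
  near=> n; have := mJ (u n + t *: d); rewrite JD (innerC d); have := uJ n; lra.
rewrite innerC; set c := _ - _ in key *.
(* Near the minimizer t = -c / |d|^2 of the quadratic; the added 1 covers d = 0 and still forces c =
   0. *)
have := key (- c / (1 + `|d| ^+ 2)); set D := `|d| ^+ 2.
have D0 : 0 <= D by rewrite exprn_ge0.
have D1 : 0 < 1 + D by lra.
have -> : 2 * (- c / (1 + D)) * c + (- c / (1 + D)) ^+ 2 * D
       = - ((2 + D) / (1 + D) ^+ 2 * c ^+ 2) by field; rewrite gt_eqF.
rewrite oppr_ge0 pmulr_rle0 ?divr_gt0 ?exprn_gt0//; last by lra.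
by move=> h; rewrite -sqrf_eq0 eq_le h sqr_ge0.
Unshelve. all: by end_near. Qed.

End InnerProduct.

(** * The order of a self-dual cone: suprema of chains and least fixed points *)

Section ConeOrder.
Context {R : realType} {H : hilbertType R} {P : set H}.
Context (hP : self_dual_cone P).
Implicit Types (x y z a b : H) (u : nat -> H) (S : H -> H).

Lemma cone0 : P 0.
Proof. by rewrite (cone_self_dual hP) => y _; rewrite inner0l. Qed.

Lemma cone_le_refl x : cone_le P x x.
Proof. by rewrite /cone_le subrr; exact: cone0. Qed.

Lemma cone_le_trans y x z : cone_le P x y -> cone_le P y z -> cone_le P x z.
Proof.
by move=> xy yz; rewrite /cone_le -(subrKA y) addrC; apply: (cone_add hP).
Qed.

Lemma cone_inner_ge0 x y : P x -> P y -> 0 <= inner x y.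
Proof. by move=> + Py; rewrite {1}(cone_self_dual hP); apply. Qed.

Lemma cone_le_anti x y : cone_le P x y -> cone_le P y x -> x = y.
Proof.
move=> xy yx; apply/esym/eqP; rewrite -subr_eq0 -normr_eq0 -sqrf_eq0 eq_le.
rewrite sqr_ge0 -innerxx andbT -oppr_ge0 -innerNr opprB.
exact: cone_inner_ge0.
Qed.

Lemma cone_approx x :
  (forall e : R, 0 < e -> exists2 q, P q & `|x - q| < e) -> P x.
Proof.
move=> h; apply: (cone_closed hP) => B /nbhs_ballP[e /= e0 eB].
have [q Pq xq] := h e e0; exists q; split=> //; apply: eB.
by rewrite -ball_normE.
Qed.

Lemma cone_cvg u x : u @ \oo --> x -> (forall n, P (u n)) -> P x.
Proof.
move=> ux Pu; apply: (closed_cvg P (cone_closed hP) _ _ ux).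
exact: nearW.
Qed.

Lemma cone_le_cvgl u x y :
  u @ \oo --> x -> (forall n, cone_le P (u n) y) -> cone_le P x y.
Proof. by move=> ux; apply: cone_cvg; apply: cvgB => //; exact: cvg_cst. Qed.

(** Both increments lie in the cone, so self-duality makes the cross term of |(z - y) + (y - x)|^2
    non-negative. *)
Lemma cone_le_dist x y z : cone_le P x y -> cone_le P y z ->
  `|y - x| ^+ 2 + `|z - y| ^+ 2 <= `|z - x| ^+ 2.
Proof.
move=> xy yz; rewrite -(subrKA y z (- x)) (sqr_normD (z - y)).
have := cone_inner_ge0 yz xy.  lra.
Qed.

(* The function x |-> |x - a|^2 is strictly increasing on {x | a <= x}, so that
   a maximizing sequence for it in the chain converges to the supremum. *)
Lemma chain_sup (A : set H) a b : A !=set0 ->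
  (forall x y, A x -> A y -> cone_le P x y \/ cone_le P y x) ->
  (forall x, A x -> cone_itv P a b x) ->
  exists x, (forall y, A y -> cone_le P y x) /\
            (forall e : R, 0 < e -> exists2 y, A y & `|x - y| < e).
Proof.
move=> [x0 Ax0] Atot Aab.
pose f x := `|x - a| ^+ 2; pose r := sup (f @` A).
have f_mono x y : A x -> cone_le P x y -> `|y - x| ^+ 2 <= f y - f x.
  by move=> /Aab[ax _] xy; rewrite lerBrDl cone_le_dist.
have f_sup : has_sup (f @` A).
  split; first by exists (f x0), x0.
  exists (f b) => _ [x Ax <-].
  have := f_mono x b Ax (Aab x Ax).2; have := sqr_ge0 `|b - x|; lra.
have fr x : A x -> f x <= r by move=> Ax; apply: ub_le_sup; [exact: f_sup.2|exists x].
have h0 n : 0 < harmonic n :> R by exact: harmonic_gt0.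
have /choice[u uP] : forall n : nat, exists x, A x /\ r - harmonic n < f x.
  move=> n; have [_ [x Ax <-] ?] := @sup_adherent _ _ (harmonic n) (h0 n) f_sup.
  by exists x.
have /cvg_ex[/= x ux] : cvg (u @ \oo).
  apply: (cvg_dist_sqr _ (@cvg_harmonic R)) => m n.
  have [[Am fm] [An fn]] := (uP m, uP n).
  (* The larger of the two elements has f at most r, the smaller one has f above r minus its
     harmonic term. *)
  have [/(f_mono _ _ Am)|/(f_mono _ _ An)] := Atot _ _ Am An.
    rewrite distrC; have := fr _ An; have := h0 n; lra.
  have := fr _ Am; have := h0 m; lra.
exists x; split=> [y Ay|e e0]; last first.
  near \oo => n; exists (u n); first by have [] := uP n.
  by near: n; apply: cvgr_dist_lt.
apply: cone_approx => e e0; have e20 : 0 < e / 2 by rewrite divr_gt0.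
near \oo => n; have [An fn] := uP n.
have xun : `|x - u n| < e / 2 by near: n; apply: cvgr_dist_lt.
(* If y <= u_n, then u_n - y is a cone element close to x - y. Otherwise f(u_n) <= f(y) <= r forces
   y close to u_n, so that 0 is close to x - y. *)
have [yu|uy] := Atot _ _ Ay An.
  by exists (u n - y) => //; rewrite opprB addrA subrK; lra.
exists 0; first exact: cone0.
rewrite subr0 -(subrKA (u n) x (- y)); apply: le_lt_trans (ler_normD _ _) _.
suff : `|u n - y| < e / 2 by lra.
rewrite distrC -(@ltr_pXn2r _ 2) ?nnegrE ?(ltW e20)//.
have := f_mono _ _ An uy; have := fr _ Ay => h1 h2.
have : `|harmonic n| < (e / 2) ^+ 2.
  near: n; apply: cvgr0_norm_lt; first exact: cvg_harmonic.
  by rewrite exprn_gt0.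
have := ler_norm (harmonic n : R); lra.
Unshelve. all: by end_near. Qed.

Lemma nondecreasing_le u :
  (forall n, cone_le P (u n) (u n.+1)) ->
  forall m n, (m <= n)%N -> cone_le P (u m) (u n).
Proof.
move=> u_nd m n /subnK <-; elim: (n - m)%N => [|k IH]; first exact: cone_le_refl.
by rewrite addSn; apply: cone_le_trans IH _.
Qed.

Lemma nondecreasing_bounded_cvg u b :
  (forall n, cone_le P (u n) (u n.+1)) -> (forall n, cone_le P (u n) b) ->
  exists x, u @ \oo --> x /\ forall n, cone_le P (u n) x.
Proof.
move=> /nondecreasing_le u_nd ub.
have [||_ [n _ <-]|x [ux xu]] := @chain_sup (range u) (u 0%N) b.
- by exists (u 0%N), 0%N.
- by move=> _ _ [m _ <-] [n _ <-]; have [/u_nd|/ltnW/u_nd] := leqP m n; [left|right].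
- by split; [exact: u_nd | exact: ub].
exists x; split=> [|n]; last by apply: ux; exists n.
(* Terms after [u m] lie between [u m] and x, hence are no farther from x. *)
apply/cvgrPdist_lt => e e0; have [_ [m _ <-] xm] := xu e e0.
exists m => // n /= mn; apply: le_lt_trans xm.
rewrite -(@ler_pXn2r _ 2) ?nnegrE//.
have : `|u n - u m| ^+ 2 + `|x - u n| ^+ 2 <= `|x - u m| ^+ 2.
  by apply: cone_le_dist; [exact: u_nd | apply: ux; exists n].
have := sqr_ge0 `|u n - u m|; lra.
Qed.

(** Zorn's lemma on the points x <= S x that lie below every z with S z <= z. Minimality among such
    z, not just among fixed points, allows comparing different maps: a fixed point of a larger map
    satisfies S z <= z. *)
Lemma least_prefixpoint S a b :
  (forall x y, cone_le P x y -> cone_le P (S x) (S y)) ->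
  cone_le P a b -> cone_le P a (S a) -> cone_le P (S b) b ->
  exists m, [/\ cone_itv P a b m, S m = m &
    forall z, cone_itv P a b z -> cone_le P (S z) z -> cone_le P m z].
Proof.
move=> S_mono ab aSa Sbb.
pose D x := [/\ cone_itv P a b x, cone_le P x (S x) &
  forall z, cone_itv P a b z -> cone_le P (S z) z -> cone_le P x z].
have Da : D a by split=> // [|z []//]; split=> //; exact: cone_le_refl.
pose le_D (s t : {x | D x}) := `[< cone_le P (sval s) (sval t) >].
have [||||[m Dm] m_max] := @Zorn {x | D x} le_D.
- by move=> s; apply/asboolP; exact: cone_le_refl.
- move=> r s t /asboolP rs /asboolP st; apply/asboolP; exact: cone_le_trans st.
- move=> [s Ds] [t Dt] /asboolP/= st /asboolP/= ts.
  by apply: eq_exist; exact: cone_le_anti.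
- move=> A Atot.
  have [->|/set0P[s0 As0]] := eqVneq A set0; first by exists (exist _ a Da).
  have [||_ [s _ <-]|x [Ax xA]] := @chain_sup (sval @` A) a b.
  + by exists (sval s0), s0.
  + move=> _ _ [s As <-] [t At <-].
    by have [/asboolP|/asboolP] := Atot s t As At; [left|right].
  + by case: (svalP s).
  (* As x is a limit of chain elements and the cone is closed, x is the least upper bound. *)
  have ge_x z : (forall s, A s -> cone_le P (sval s) z) -> cone_le P x z.
    move=> Az; apply: cone_approx => e /xA[_ [s As <-] xs].
    exists (z - sval s); first exact: Az.
    by rewrite opprB addrC subrKA distrC.
  have Dx : D x.
    split.
    - split; last by apply: ge_x => s _; case: (svalP s) => -[].
      by apply: cone_le_trans (Ax _ _); [| by exists s0]; case: (svalP s0) => -[].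
    - apply: ge_x => s As; apply: (@cone_le_trans (S (sval s))).
        by case: (svalP s).
      by apply/S_mono/Ax; exists s.
    - by move=> z zab Szz; apply: ge_x => s _; case: (svalP s) => _ _; apply.
  by exists (exist _ x Dx) => s As; apply/asboolP/Ax; exists s.
have [[am mb] mSm m_le] := Dm; exists m; split=> //.
(* [D] is stable under S and m <= S m, so maximality of m yields S m = m. *)
have DSm : D (S m).
  split; last first.
  - move=> z zab Szz; apply: (cone_le_trans _ Szz).
    exact/S_mono/m_le.
  - exact: S_mono.
  - split; first exact: cone_le_trans mSm.
    by apply: cone_le_trans Sbb; exact: S_mono.
by have /(congr1 sval) := m_max (exist _ _ DSm) (asboolT mSm).
Qed.

End ConeOrder.

(** * The opposite cone *)

Lemma opp_self_dual_cone (R : realType) (H : hilbertType R) (P : set H) :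
  self_dual_cone P -> self_dual_cone [set x | P (- x)].
Proof.
move=> hP; split.
- apply: (closed_comp _ (cone_closed hP)) => x _; exact: oppr_continuous.
- by move=> x y Px Py /=; rewrite opprD; apply: (cone_add hP).
- by move=> a x a0 Px /=; rewrite -scalerN; apply: (cone_scale hP).
apply/seteqP; split=> x /= Px => [y Py|].
  by rewrite -(opprK x) -(opprK y) innerNl innerNr opprK (cone_inner_ge0 hP).
rewrite (cone_self_dual hP) => y Py.
by rewrite innerNl -innerNr; apply: Px; rewrite opprK.
Qed.

(** An equality of relations, so that one rewrite reverses the order throughout a statement. *)
Lemma opp_cone_le (R : realType) (H : hilbertType R) (P : set H) :
  cone_le [set x | P (- x)] = fun x y => cone_le P y x.
Proof. by apply/funext => x; apply/funext => y; rewrite /cone_le /= opprB. Qed.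

(** * Bounded functionals and weak limits in the Gelfand triple *)

Lemma continuous_scalar_bounded (R : realType) (V : normedModType R)
    (phi : {scalar V}) :
  continuous phi -> exists C, forall v, `|phi v| <= C * `|v|.
Proof.
move=> /(_ 0)/cvgrPdist_le/(_ 1 ltr01)/nbhs_ballP[d /= d0 dphi].
exists (2 / d) => v; have [->|v0] := eqVneq v 0.
  by rewrite linear0 !normr0 mulr0.
have {}v0 : 0 < `|v| by rewrite normr_gt0.
(* The functional is at most 1 on the ball of radius d; v is rescaled to norm d/2, whence the
   constant 2/d. *)
have t0 : 0 < d / 2 / `|v| by rewrite !divr_gt0.
have := dphi ((d / 2 / `|v|) *: v).
rewrite -ball_normE /= linear0 !sub0r !normrN linearZ /= normrZ (normrM _ (phi v)).
rewrite (gtr0_norm t0) divfK ?gt_eqF// => dphi1.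
have {}dphi1 : d / 2 / `|v| * `|phi v| <= 1 by apply: dphi1; lra.
by rewrite -(ler_pM2l t0); apply: le_trans dphi1 _; rewrite le_eqVlt; apply/orP;
   left; apply/eqP; field; rewrite !gt_eqF.
Qed.

Section GelfandWeakLimit.
Context {R : realType} {V H : hilbertType R}.
Context (i : {linear V -> H}) (hVH : gelfand_triple i).

(* H is dense in V', so boundedness in V together with convergence in H makes
   (phi (u n)) a Cauchy sequence for every phi in V'. *)
Lemma bounded_cvg_weakly (u : nat -> V) (h : H) (C : R) :
  (forall n, `|u n| <= C) -> i (u n) @[n --> \oo] --> h ->
  exists2 l, i l = h & weakly_converges u l.
Proof.
move=> uC iuh.
have C0 : 0 <= C by exact: le_trans (uC 0%N).
have phi_cvg y : cvg (inner y (u n) @[n --> \oo]).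
  apply/cauchy_cvgP/cauchy_exP => e e0.
  (* An approximation error that stays below e/4 on vectors of norm at most C; the added 1 allows C
     = 0. *)
  have e1 : 0 < e / (4 * (C + 1)) by rewrite divr_gt0// mulr_gt0//; lra.
  have [k hk] := H_V'_dense hVH (phi := inner y) (@inner_continuous _ _ y) e1.
  have {}hk n : `|inner y (u n) - inner k (i (u n))| <= e / 4.
    have -> : e / 4 = e / (4 * (C + 1)) * (C + 1) by field; rewrite gt_eqF//; lra.
    apply: le_trans (hk _) _; rewrite ler_wpM2l ?(ltW e1)//.
    by rewrite (le_trans (uC n))//; lra.
  (* The centre of the Cauchy ball is the limit of [inner k (i (u n))], known from convergence in
     H. *)
  exists (inner k h).
  suff : \forall n \near \oo, ball (inner k h) e (inner y (u n)) by [].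
  near=> n; rewrite -ball_normE /=.
  have : `|inner k h - inner k (i (u n))| < e / 2.
    near: n; apply: cvgr_dist_lt; last by rewrite divr_gt0.
    exact: cvg_inner.
  have := hk n; move: (inner k h) (inner k _) (inner y _) => p q r.
  by rewrite (distrC r); have := ler_distD q p r; lra.
(* The pointwise limit is linear and bounded by C, so Riesz turns it into the weak limit l. *)
pose L y := lim (inner y (u n) @[n --> \oo]).
have Lcvg y : inner y (u n) @[n --> \oo] --> L y := phi_cvg y.
have [l Ll] : exists l, L = inner l.
  apply: (@riesz _ _ _ C) => [a x y|y].
    apply/cvg_lim => //; rewrite (_ : (fun n => _) =
        fun n => a * inner x (u n) + inner y (u n)).
      by apply: cvgD (Lcvg y); apply: cvgMr; exact: Lcvg.
    by apply/funext => n; rewrite innerPl.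
  have Ln : `|inner y (u n)| @[n --> \oo] --> `|L y| by apply: cvg_norm.
  rewrite -(cvg_lim _ Ln)//; apply: limr_le; first by apply/cvg_ex; exists `|L y|.
  near=> n; rewrite (le_trans (cauchy_schwarz _ _))// mulrC ler_wpM2r//.
have ul : weakly_converges u l.
  move=> phi phi_cont; have [K phiK] := continuous_scalar_bounded phi_cont.
  have [|y phiE] := @riesz _ _ phi K _ phiK; first by move=> a x y; rewrite linearP.
  by rewrite phiE innerC -Ll; exact: Lcvg.
exists l => //; apply/eqP; rewrite -subr_eq0 -normr_eq0 -sqrf_eq0 -innerxx.
(* The functional v |-> (k, i v) is bounded on V, so (k, i u_n) tends to (k, i l) by weak
   convergence and to (k, h) by convergence in H; hence (k, k) = 0. *)
set k := i l - h.
have kl : inner k (i (u n)) @[n --> \oo] --> inner k (i l).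
  have [K HK] := H_V'_continuous hVH.
  have [|y phiE] := @riesz _ _ (inner k \o i) (K * `|k|) _ (HK k).
    by move=> a x y /=; rewrite linearP innerDr innerZr.
  rewrite (_ : (fun n => _) = fun n => (inner k \o i) (u n))//.
  rewrite (_ : inner k (i l) = (inner k \o i) l)//.
  by rewrite phiE innerC -Ll; exact: Lcvg.
rewrite innerDr innerNr subr_eq0; apply/eqP.
by rewrite -(cvg_lim _ kl)// -(cvg_lim _ (cvg_inner (x := k) iuh)).
Unshelve. all: by end_near. Qed.

End GelfandWeakLimit.

(** * Convergence of smallest and largest fixed points *)

(** Stated for one family and arbitrary endpoints, so that it also applies to the opposite cone with
    the endpoints exchanged. *)
Lemma smallest_fixpoints_cvg (R : realType) (V H : hilbertType R)
    (i : {linear V -> H}) (hVH : gelfand_triple i)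
    (P : set H) (hP : self_dual_cone P) (T : H -> V) (Rn : nat -> H -> V)
    (hT : increasing i P T) (hRn : forall n, increasing i P (Rn n))
    (T_cont : forall (v : nat -> V) (l : V), weakly_converges v l ->
      (forall n, cone_le P (i (v n)) (i (v n.+1))) ->
      T (i (v n)) @[n --> \oo] --> T (i l))
    (fix_bounded : exists C : R, forall v n, Rn n (i v) = v -> `|v| <= C)
    (a b : H) (hab : cone_le P a b)
    (Rn_T : forall v n, cone_itv P a b v ->
      [/\ cone_le P a (i (Rn n v)), cone_le P (i (Rn n v)) (i (Rn n.+1 v)),
          cone_le P (i (Rn n v)) (i (T v)) & cone_le P (i (T v)) b])
    (Rn_cvg : forall v : nat -> V, (exists C : R, forall n, `|v n| <= C) ->
      (forall n, cone_le P (i (v n)) (i (v n.+1)) /\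
                 cone_le P (i (v n.+1)) b) ->
      `|Rn n (i (v n)) - T (i (v n))| @[n --> \oo] --> (0 : R)) :
  exists (mT : H) (mR : nat -> H),
    [/\ is_smallest_fixpoint P (i \o T) a b mT,
        forall n, is_smallest_fixpoint P (i \o Rn n) a b (mR n),
        converges_in_V i mR mT & increases_to P mR mT].
Proof.
have a_ab : cone_itv P a b a by split=> //; exact: cone_le_refl.
have b_ab : cone_itv P a b b by split=> //; exact: cone_le_refl.
have Rn_itv v n : cone_itv P a b v -> cone_itv P a b (i (Rn n v)).
  by move=> /(Rn_T _ n)[aR _ RT Tb]; split=> //; exact: cone_le_trans Tb.
have T_itv v : cone_itv P a b v -> cone_itv P a b (i (T v)).
  by move=> /(Rn_T _ 0%N)[aR _ RT Tb]; split=> //; exact: cone_le_trans RT.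
have [m [m_ab Tm m_le]] := least_prefixpoint hP hT hab (T_itv _ a_ab).1
  (T_itv _ b_ab).2.
have /choice[mR mRP] n := least_prefixpoint hP (hRn n) hab
  (Rn_itv _ n a_ab).1 (Rn_itv _ n b_ab).2.
(* The representative in V of the fixed point [mR n], which itself is only an element of H. *)
pose u n := Rn n (mR n).
have iu n : i (u n) = mR n by case: (mRP n).
have mR_le n z : cone_itv P a b z -> cone_le P (i (Rn n z)) z ->
    cone_le P (mR n) z by case: (mRP n) => _ _; apply.
have mR_ab n : cone_itv P a b (mR n) by case: (mRP n).
have mR_nd n : cone_le P (mR n) (mR n.+1).
  (* R_n <= R_{n+1} gives R_n z <= z at z = m(R_{n+1}); the bound by m follows likewise from R_n <=
     T. *)
  apply: mR_le => //; rewrite -[X in cone_le P _ X]iu.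
  by case: (Rn_T _ n (mR_ab n.+1)).
have mR_m n : cone_le P (mR n) m.
  by apply: mR_le => //; rewrite -[X in cone_le P _ X]Tm; case: (Rn_T _ n m_ab).
have [h [mRh mR_h]] := nondecreasing_bounded_cvg hP mR_nd mR_m.
have [C uC] : exists C : R, forall n, `|u n| <= C.
  by have [C hC] := fix_bounded; exists C => n; apply: (hC _ n); rewrite iu.
have iuh : i (u n) @[n --> \oo] --> h.
  by rewrite (_ : (fun n => _) = mR)//; apply/funext.
have [l il ul] := bounded_cvg_weakly hVH uC iuh.
have Tul : T (i (u n)) @[n --> \oo] --> T h.
  by rewrite -il; apply: T_cont => // n; rewrite !iu.
have uTh : u @ \oo --> T h.
  (* Since u_n = R_n(u_n), splitting off T(u_n) upgrades weak to norm convergence. *)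
  have : (Rn n (i (u n)) - T (i (u n))) + T (i (u n)) @[n --> \oo] --> 0 + T h.
    apply: cvgD => //; apply/norm_cvg0P; apply: Rn_cvg; first by exists C.
    by move=> n; rewrite !iu; split=> //; case: (mR_ab n.+1).
  rewrite add0r; apply: cvg_trans; apply: near_eq_cvg; apply: nearW => n.
  by rewrite subrK iu.
have iTh : i (T h) = h.
  have iuTh : i (u n) @[n --> \oo] --> i (T h).
    by apply: continuous_cvg => //; exact: (V_H_continuous hVH).
  by rewrite -(cvg_lim _ iuTh)//; exact: cvg_lim iuh.
have h_ab : cone_itv P a b h.
  split; first exact: cone_le_trans (mR_ab 0%N).1 (mR_h 0%N).
  by apply: (cone_le_cvgl hP mRh) => n; case: (mR_ab n).
(* h <= m passes to the limit from m(R_n) <= m; m <= h because h is a fixed point of T in the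
   interval. *)
have hm : h = m.
  apply: (cone_le_anti hP); first exact: cone_le_cvgl mRh mR_m.
  by apply: m_le => //=; rewrite iTh; exact: cone_le_refl.
have fix_le S z : S z = z -> cone_le P (S z) z.
  by move=> ->; exact: cone_le_refl.
exists m, mR; split.
- by split=> // z zab Tz; apply: m_le => //; exact: (fix_le (i \o T)).
- move=> n; split=> [//|/=|z zab Rz]; first exact: iu.
  by apply: mR_le => //; exact: (fix_le (i \o Rn n)).
- by exists u, (T h); split=> //; rewrite iTh.
- by split=> //; rewrite -hm.
Qed.

Theorem theorem4 (R : realType)
  (V H : hilbertType R) (i : {linear V -> H}) (hVH : gelfand_triple i)
  (P : set H) (hP : self_dual_cone P) (hpos : pos_part_bounded i P)
  (N : nat) (hN : (0 < N)%N) (Omega : set 'rV[R]_N)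
  (hOmega : open Omega)
  (ev : H -> 'rV[R]_N -> R) (hev : function_space Omega ev)
  (hLinfty : Linfty_embedded Omega ev)
  (T : H -> V) (Rn Un : nat -> H -> V)
  (hT : increasing i P T)
  (hRn : forall n, increasing i P (Rn n))
  (hUn : forall n, increasing i P (Un n))
  (h_i : forall (v : nat -> V) (l : V),
    weakly_converges v l ->
    (forall n, cone_le P (i (v n)) (i (v n.+1))) \/
    (forall n, cone_le P (i (v n.+1)) (i (v n))) ->
    T (i (v n)) @[n --> \oo] --> T (i l))
  (h_ii_bounded : exists C : R, forall v : V,
    T (i v) = v \/ (exists n, Rn n (i v) = v) \/ (exists n, Un n (i v) = v) ->
    `|v| <= C)
  (ylow yup : V) (hy : cone_le P (i ylow) (i yup))
  (h_ii_order : forall (v : H) (n : nat),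
    cone_itv P (i ylow) (i yup) v ->
    cone_le P (i ylow) (i (Rn n v)) /\
    cone_le P (i (Rn n v)) (i (Rn n.+1 v)) /\
    cone_le P (i (Rn n.+1 v)) (i (T v)) /\
    cone_le P (i (T v)) (i (Un n.+1 v)) /\
    cone_le P (i (Un n.+1 v)) (i (Un n v)) /\
    cone_le P (i (Un n v)) (i yup))
  (h_iii : forall v w : nat -> V,
    (exists C : R, forall n, `|v n| <= C) ->
    (exists C : R, forall n, `|w n| <= C) ->
    (forall n, cone_le P (i (v n)) (i (v n.+1)) /\
               cone_le P (i (v n.+1)) (i yup)) ->
    (forall n, cone_le P (i (w n.+1)) (i (w n)) /\
               cone_le P (i ylow) (i (w n.+1))) ->
    `|Rn n (i (v n)) - T (i (v n))| @[n --> \oo] --> (0 : R) /\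
    `|Un n (i (w n)) - T (i (w n))| @[n --> \oo] --> (0 : R)) :
  exists (mT MT : H) (mR MU : nat -> H),
    [/\ is_smallest_fixpoint P (i \o T) (i ylow) (i yup) mT,
        is_largest_fixpoint P (i \o T) (i ylow) (i yup) MT,
        (forall n, is_smallest_fixpoint P (i \o Rn n) (i ylow) (i yup) (mR n)) &
        (forall n, is_largest_fixpoint P (i \o Un n) (i ylow) (i yup) (MU n))] /\
    [/\ converges_in_V i mR mT,
        converges_in_V i MU MT,
        increases_to P mR mT &
        decreases_to P MU MT].
Proof.
have [C hC] := h_ii_bounded.
have [] := @smallest_fixpoints_cvg R V H i hVH P hP T Rn hT hRn _ _ (i ylow) (i yup).
- by move=> v l vl v_nd; apply: h_i => //; left.
- by exists C => v n Rv; apply: hC; right; left; exists n.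
- exact: hy.
- move=> v n vab; have [aR [RR [RT _]]] := h_ii_order v n vab.
  have [_ [_ [_ [TU [UU Ub]]]]] := h_ii_order v n vab.
  split=> //; first exact: cone_le_trans RT.
  exact: cone_le_trans TU (cone_le_trans hP UU Ub).
(* The constant sequence [ylow] is an admissible decreasing partner in [h_iii]. *)
- move=> v v_bd v_nd; apply: (h_iii v (fun=> ylow) v_bd _ v_nd _).1.
    by exists `|ylow|.
  by move=> n; split; exact: cone_le_refl.
move=> mT [mR [mTP mRP mR_V mR_H]].
have U_inc n : increasing i [set x | P (- x)] (Un n).
  by rewrite /increasing opp_cone_le => v w; exact: hUn.
have T_inc : increasing i [set x | P (- x)] T.
  by rewrite /increasing opp_cone_le => v w; exact: hT.
(* For the opposite cone the interval runs from [yup] to [ylow]; unfolding and rewriting express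
   everything in the original order. *)
have := @smallest_fixpoints_cvg R V H i hVH _ (opp_self_dual_cone hP) T Un T_inc
  U_inc _ _ (i yup) (i ylow).
rewrite /cone_itv /is_smallest_fixpoint /increases_to /cone_itv !opp_cone_le.
move=> [].
- by move=> v l vl v_nd; apply: h_i => //; right.
- by exists C => v n Uv; apply: hC; right; right; exists n.
- exact: hy.
- move=> v n [vb av]; have vab : cone_itv P (i ylow) (i yup) v by [].
  have [aR [RR [RT [TU [UU Ub]]]]] := h_ii_order v n vab.
  split=> //; first exact: cone_le_trans TU UU.
  exact: cone_le_trans aR (cone_le_trans hP RR RT).
- move=> v v_bd v_nd; apply: (h_iii (fun=> yup) v _ v_bd _ v_nd).2.
    by exists `|yup|.
  by move=> n; split; exact: cone_le_refl.
move=> MT [MU [[[MTb MTa] MT_fix MT_le] MUP MU_V MU_H]].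
exists mT, MT, mR, MU; split; split=> //.
  by split=> // z [az zb]; exact: MT_le.
move=> n; have [[MUb MUa] MU_fix MU_le] := MUP n.
by split=> // z [az zb]; exact: MU_le.
Qed.
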